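(* Let $\Pi$ be a bicriteria minimization problem with positive-valued, polynomially computable objective functions, let $0<\epsilon\le 1$, and suppose that a polynomial-time parametric $\alpha$-approximation algorithm for the weighted sum problem $\Pi^{\mathrm{WS}}$ is given. Then the set of solutions returned by the parametric $\alpha$-approximation algorithm is an $\left(\alpha\cdot(1+\epsilon),\ \alpha\cdot\left(1+\frac{1}{\epsilon}\right)\right)$-approximate Pareto curve. The running time for obtaining this set is equal to the running time of the parametric algorithm.
   Context: Bicriteria minimization problem $\Pi$: each instance $I$ has a set $S(I)$ of feasible solutions, and two objective functions to be minimized are given by polynomial-time algorithms $f_1,f_2$ that, given $I$ and $x\in S(I)$, compute positive rational numbers $f_1(I,x), f_2(I,x)$. For each instance $I$ and $i=1,2$ there are positive rationals $\mathrm{LB}(I,i),\mathrm{UB}(I,i)$, of encoding length polynomial in the encoding length $|I|$, with $\mathrm{LB}(I,i)\le f_i(I,x)\le \mathrm{UB}(I,i)$ for all $x\in S(I)$. Weighted sum problem $\Pi^{\mathrm{WS}}(\gamma)$, $\gamma>0$: given an instance $I$, find $x\in S(I)$ minimizing $f_1(I,x)+\gamma\cdot f_2(I,x)$ over $S(I)$. An $\alpha$-approximate solution ($\alpha\ge1$) is an $x\in S(I)$ whose weighted sum objective value is at most $\alpha$ times the optimal objective value. A polynomial-time parametric $\alpha$-approximation algorithm for $\Pi^{\mathrm{WS}}$ is an algorithm that, given an instance $I$, computes in polynomial time a sequence of $\alpha$-approximate solutions for $\Pi^{\mathrm{WS}}(\gamma)$ for all $\gamma>0$ simultaneously (the output usually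 consists of a sequence of polynomially many intervals for $\gamma$ and, for each interval, a corresponding solution that is $\alpha$-approximate for all $\gamma$ in the interval); thus for every $\gamma>0$ the set of returned solutions contains an $\alpha$-approximate solution of $\Pi^{\mathrm{WS}}(\gamma)$. For $\alpha',\beta'\ge1$, an $(\alpha',\beta')$-approximate Pareto curve for an instance $I$ is a set $P$ of feasible solutions such that for every $x\in S(I)$ there exists $x'\in P$ with $f_1(I,x')\le\alpha'\cdot f_1(I,x)$ and $f_2(I,x')\le\beta'\cdot f_2(I,x)$. *)

(* Defs.v *)
From mathcomp Require Import all_boot all_order all_algebra.
From mathcomp Require Import boolp classical_sets reals.

Set Implicit Arguments.
Unset Strict Implicit.
Unset Printing Implicit Defensive.

Import Order.TTheory GRing.Theory Num.Theory.
Local Open Scope ring_scope.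
Local Open Scope classical_set_scope.

(** * Binary encodings *)

Definition word := seq bool.

(* Prefix-free code: every bit is announced by [true], the end by [false]. *)
Definition delimit (w : word) : word :=
  flatten [seq [:: true; b] | b <- w] ++ [:: false].

Definition enc_words (ws : seq word) : word := flatten [seq delimit w | w <- ws].

(* Least significant bit first; the number 0 is the empty word. *)
Fixpoint enc_pos (p : BinNums.positive) : word :=
  match p with
  | BinNums.xH => [:: true]
  | BinNums.xO q => false :: enc_pos q
  | BinNums.xI q => true :: enc_pos q
  end.

Definition enc_nat (n : nat) : word :=
  if bin_of_nat n is BinNums.Npos p then enc_pos p else [::].

Definition enc_int (z : int) : word := (z < 0) :: enc_nat `|z|%N.

Definition enc_rat (q : rat) : word :=
  enc_words [:: enc_int (numq q); enc_int (denq q)].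

(** * Deterministic multitape Turing machines *)

(* A tape symbol is the blank [None], an input/output bit, or one of the
   machine's own work symbols. *)
Definition symbol (W : finType) : finType := option (bool + W)%type.

Inductive move := MoveLeft | Stay | MoveRight.

(* Tape 0 holds the input at the beginning and the output at the end. The
   domain of [delta] is finite, so [delta] is a finite table. *)
Record turing_machine := TuringMachine {
  extra_tapes : nat;
  state : finType;
  work : finType;
  start : state;
  halting : {set state};
  delta : state -> {ffun 'I_extra_tapes.+1 -> symbol work} ->
          state * ('I_extra_tapes.+1 -> symbol work * move)
}.

(* A two-way infinite tape; the left part is listed from the head outwards, and
   all cells that are not listed are blank. *)
Record tape (W : finType) := Tape {
  left_part : seq (symbol W);
  scanned : symbol W;
  right_part : seq (symbol W)
}.

Definition tape_of (W : finType) (s : seq (symbol W)) : tape W :=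
  Tape [::] (head None s) (behead s).

Definition write_move (W : finType) (T : tape W) (a : symbol W * move) :=
  let: Tape l _ r := T in
  match a.2 with
  | MoveLeft => Tape (behead l) (head None l) (a.1 :: r)
  | Stay => Tape l a.1 r
  | MoveRight => Tape (a.1 :: l) (head None r) (behead r)
  end.

Record config (M : turing_machine) := Config {
  current : state M;
  tapes : 'I_(extra_tapes M).+1 -> tape (work M)
}.

Definition init (M : turing_machine) (w : word) : config M :=
  Config (start M)
    (fun k => tape_of (if k == ord0 then [seq Some (inl b) | b <- w] else [::])).

Definition step (M : turing_machine) (c : config M) : config M :=
  let d := delta (current c) [ffun k => scanned (tapes c k)] in
  Config d.1 (fun k => write_move (tapes c k) (d.2 k)).

(* The bits from the head rightwards, up to the first symbol that is no bit. *)
Fixpoint leading_bits (W : finType) (s : seq (symbol W)) : word :=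
  if s is Some (inl b) :: s' then b :: leading_bits s' else [::].

Definition output (M : turing_machine) (c : config M) : word :=
  let T := tapes c ord0 in leading_bits (scanned T :: right_part T).

(* On input [w], [M] halts after exactly [t] steps with output [v]. *)
Definition runs (M : turing_machine) (w : word) (t : nat) (v : word) : Prop :=
  let c n := iter n (@step M) (init M w) in
  [/\ current (c t) \in halting M,
      forall n, (n < t)%N -> current (c n) \notin halting M
    & output (c t) = v].

(** * Bicriteria minimization problems *)

(* The index [0 : 'I_2] is the first objective and [1 : 'I_2] the second. *)
Record bicriteria_problem := BicriteriaProblem {
  instance : Type;
  solution : eqType;
  enc_inst : instance -> word;
  enc_sol : solution -> word;
  enc_inst_inj : injective enc_inst;
  enc_sol_inj : injective enc_sol;
  feasible : instance -> set solution;
  obj : 'I_2 -> instance -> solution -> rat;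
  LB : 'I_2 -> instance -> rat;
  UB : 'I_2 -> instance -> rat;
  obj_gt0 : forall i I x, feasible I x -> 0 < obj i I x;
  obj_poly_time : forall i, exists (M : turing_machine) (p : {poly nat}),
    forall I x, feasible I x ->
      let w := enc_words [:: enc_inst I; enc_sol x] in
      exists2 t, (t <= p.[size w])%N & runs M w t (enc_rat (obj i I x));
  LB_gt0 : forall i I, 0 < LB i I;
  UB_gt0 : forall i I, 0 < UB i I;
  LB_poly_length : forall i, exists p : {poly nat},
    forall I, (size (enc_rat (LB i I)) <= p.[size (enc_inst I)])%N;
  UB_poly_length : forall i, exists p : {poly nat},
    forall I, (size (enc_rat (UB i I)) <= p.[size (enc_inst I)])%N;
  obj_bounds : forall i I x, feasible I x -> LB i I <= obj i I x <= UB i I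
}.

Section Approximation.
Variables (R : realType) (Pi : bicriteria_problem).
Implicit Types (I : instance Pi) (x : solution Pi) (A : turing_machine).

Definition objR (i : 'I_2) I x : R := ratr (obj i I x).

Definition weighted_sum (gamma : R) I x : R := objR 0 I x + gamma * objR 1 I x.

(* An infimum, because the optimum need not be attained when there are
   infinitely many feasible solutions. *)
Definition ws_opt (gamma : R) I : R :=
  inf [set weighted_sum gamma I x | x in feasible I].

Definition ws_approx_solution (alpha gamma : R) I x : Prop :=
  feasible I x /\ weighted_sum gamma I x <= alpha * ws_opt gamma I.

Definition enc_sols (s : seq (solution Pi)) : word :=
  enc_words [seq enc_sol x | x <- s].

Definition running_time A I (t : nat) : Prop :=
  exists v, runs A (enc_inst I) t v.

Definition returned A I : set (solution Pi) :=
  [set x | exists t s, runs A (enc_inst I) t (enc_sols s) /\ x \in s].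

(* On an instance without feasible solutions, the algorithm can only return the
   empty sequence. *)
Definition parametric_approx_algorithm (alpha : R) A : Prop :=
  [/\ exists p : {poly nat}, forall I,
        exists2 t, (t <= p.[size (enc_inst I)])%N
                 & exists s, runs A (enc_inst I) t (enc_sols s),
      forall I, returned A I `<=` feasible I
    & forall I (gamma : R), 0 < gamma -> feasible I !=set0 ->
        exists2 x, returned A I x & ws_approx_solution alpha gamma I x].

Definition approx_Pareto_curve (alpha' beta' : R) I
    (P : set (solution Pi)) : Prop :=
  P `<=` feasible I /\
  forall x, feasible I x ->
    exists x', [/\ P x', objR 0 I x' <= alpha' * objR 0 I x
                       & objR 1 I x' <= beta' * objR 1 I x].

End Approximation.

(* Main.v *)
(** Given a feasible [x], choose the weight [gamma = epsilon * f_1 x / f_2 x]: the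
    weighted sum of [x] is then both [(1 + epsilon) * f_1 x] and
    [gamma * (1 + 1 / epsilon) * f_2 x], and since the objectives are positive
    each term [f_1 x'], [gamma * f_2 x'] of a returned solution [x'] that is
    [alpha]-approximate for [gamma] is at most [alpha] times this sum. *)
Require Import Defs.
From mathcomp Require Import all_boot all_order all_algebra.
From mathcomp Require Import boolp classical_sets reals.
From mathcomp Require Import ring.

Import Order.TTheory GRing.Theory Num.Theory.
Local Open Scope ring_scope.
Local Open Scope classical_set_scope.

Lemma objR_gt0 (R : realType) (Pi : bicriteria_problem) (i : 'I_2)
    (I : instance Pi) (x : solution Pi) :
  feasible I x -> 0 < objR R i I x.
Proof. by move=> Ix; rewrite /objR ltr0q obj_gt0. Qed.

Lemma ws_opt_le (R : realType) (Pi : bicriteria_problem) (gamma : R)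
    (I : instance Pi) (x : solution Pi) :
  0 <= gamma -> feasible I x -> ws_opt gamma I <= weighted_sum gamma I x.
Proof.
move=> gamma_ge0 Ix; apply: ge_inf; last by exists x.
(* [ge_inf] asks for a lower bound of the set; 0 serves, since the objectives are positive and
   [gamma] is nonnegative. *)
exists 0 => _ [y Iy <-].
have fy_ge0 i : 0 <= objR R i I y by exact/ltW/objR_gt0.
by apply: addr_ge0 => //; apply: mulr_ge0.
Qed.

(** The infimum is at most the weighted sum of any feasible [x], so [alpha] times the latter bounds
    the weighted sum of [x']; dropping either of its two positive terms leaves one of the bounds. *)
Lemma ws_approx_solution_objR_le (R : realType) (Pi : bicriteria_problem)
    (alpha gamma : R) (I : instance Pi) (x x' : solution Pi) :
  0 <= alpha -> 0 < gamma -> feasible I x ->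
  ws_approx_solution alpha gamma I x' ->
  objR R 0 I x' <= alpha * weighted_sum gamma I x /\
  gamma * objR R 1 I x' <= alpha * weighted_sum gamma I x.
Proof.
move=> alpha_ge0 gamma_gt0 Ix [Ix' x'_le].
have ws_le : weighted_sum gamma I x' <= alpha * weighted_sum gamma I x.
  by rewrite (le_trans x'_le)// ler_wpM2l// ws_opt_le// ltW.
split; apply: le_trans ws_le.
  by rewrite lerDl; apply: mulr_ge0; apply: ltW => //; exact: objR_gt0.
by rewrite lerDr; exact/ltW/objR_gt0.
Qed.

Theorem mainTheorem5 (R : realType) (Pi : bicriteria_problem)
    (alpha epsilon : R) (A : turing_machine)
    (alpha_ge1 : 1 <= alpha) (epsilon_gt0 : 0 < epsilon)
    (epsilon_le1 : epsilon <= 1)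
    (A_param : parametric_approx_algorithm Pi alpha A) :
  (forall I : instance Pi,
     approx_Pareto_curve (alpha * (1 + epsilon)) (alpha * (1 + 1 / epsilon))
       I (returned A I)) /\
  (exists B : turing_machine, forall I : instance Pi,
     returned B I = returned A I /\
     (forall t : nat, running_time B I t <-> running_time A I t)).
Proof.
(* The curve is the output of [A] unchanged, so [A] itself serves as [B]. *)
split; last by exists A.
case: A_param => _ A_feasible A_approx I; split=> [|x Ix]; first exact: A_feasible.
have f1_gt0 := objR_gt0 R _ 0 I x Ix.
have f2_gt0 := objR_gt0 R _ 1 I x Ix.
set f1 := objR R 0 I x in f1_gt0 *.
set f2 := objR R 1 I x in f2_gt0 *.
pose gamma := epsilon * f1 / f2.
have gamma_gt0 : 0 < gamma by apply: divr_gt0 => //; apply: mulr_gt0.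
have [||x' Ax' x'_approx] := A_approx I gamma; [by []|by exists x|].
have alpha_ge0 : 0 <= alpha by exact: le_trans alpha_ge1.
have [le1 le2] := ws_approx_solution_objR_le _ _ _ _ _ _ _
  alpha_ge0 gamma_gt0 Ix x'_approx.
have epsilon_neq0 := lt0r_neq0 epsilon_gt0.
have f2_neq0 := lt0r_neq0 f2_gt0.
(* The choice of [gamma] gives [gamma * f2 = epsilon * f1]. *)
have ws1 : alpha * weighted_sum gamma I x = alpha * (1 + epsilon) * f1.
  by rewrite /weighted_sum -/f1 -/f2 /gamma; field.
(* The same value expressed through [f2], with [gamma] factored out so that it cancels against the
   one in [le2]. *)
have ws2 : alpha * weighted_sum gamma I x
    = gamma * (alpha * (1 + 1 / epsilon) * f2).
  by rewrite /weighted_sum -/f1 -/f2 /gamma; field; rewrite epsilon_neq0.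
exists x'; split=> //; first by rewrite -ws1.
by rewrite -(ler_pM2l gamma_gt0) -ws2.
Qed.
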